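(* Let $f:[0,1]\times\Omega\to\mathbb{R}$ be Borel measurable such that $f_t=f(t,\cdot)$ is a continuous function on $\Omega$ for $\mu$-a.e. $t\in[0,1]$. Then, for every $\varepsilon>0$, there is a set $T_\varepsilon\subset[0,1]$ with $\mu([0,1]\setminus T_\varepsilon)<\varepsilon$ such that the restriction $$f|_{T_\varepsilon\times\Omega}:T_\varepsilon\times\Omega\to\mathbb{R}$$ is a continuous function, where $T_\varepsilon\times\Omega$ carries the product of the usual topologies (induced by $|\cdot|$) on $T_\varepsilon$ and $\Omega$, and $\mathbb{R}$ its usual topology.
   Context: $\Omega=[0,1]$, and $\mu$ denotes Lebesgue measure on the index interval $[0,1]$. *)

(* Defs.v *)
From HB Require Import structures.
From mathcomp Require Import all_boot all_order all_algebra.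
From mathcomp Require Import all_classical all_reals all_analysis.

Set Implicit Arguments.
Unset Strict Implicit.
Unset Printing Implicit Defensive.

Local Open Scope classical_set_scope.

(* Borel measurability of the restriction of f to a Borel set D. The
   sigma-algebra on T is generated by its open sets, so that for T := R * R it
   is not by definition the product sigma-algebra that measurable_fun would
   infer. *)
Definition borel_measurable_fun (T : topologicalType) (R : realType)
    (D : set T) (f : T -> R) : Prop :=
  forall B : set R, measurable B -> <<s @open T >> (D `&` f @^-1` B).

(* Main.v *)
Require Import Defs.
From HB Require Import structures.
From mathcomp Require Import all_boot all_order all_algebra.
From mathcomp Require Import all_classical all_reals all_analysis.
From mathcomp Require Import measurable_realfun lra.

(** This is the Scorza-Dragoni property: Lusin's theorem applied to the
curve t |-> f (t, .) of continuous functions on a compact space K.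

Joint continuity of f on T x K follows from two facts about the sections of
f ([continuous_prod_dense_seq]): each f (., q i), for q a sequence dense in K,
is continuous on T, and the functions f (t, .), for t in T, share a modulus of
continuity. Indeed, to compare f (t, x) with f (s, y), go through f (t, q i)
and f (s, q i) for a single q i close to both x and y.

Each of these facts is a countable family of requirements on T, each of
which can be met outside a set of arbitrarily small measure; allotting
geometrically decreasing measures to them meets all of them at once
([nearly_forall]). Continuity of one section f (., q i) is Lusin's theorem.
For the common modulus at precision e, let E n be the set of the t such that
f (t, .) oscillates by at most e between points of q at distance less than
1 / (n + 1). By density this bounds the oscillation of f (t, .) on all of K
when f (t, .) is continuous, and since only countably many points are
involved, E n is measurable without any projection or measurable selection
argument. The sets E n increase with n, and by uniform continuity on the
compact K they contain almost every t, so that continuity of the measure makes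
one of them almost full ([nearly_equicontinuous]). *)

Set Implicit Arguments.
Unset Strict Implicit.
Unset Printing Implicit Defensive.

Import Order.TTheory GRing.Theory Num.Theory.
Import numFieldNormedType.Exports.

Local Open Scope classical_set_scope.
Local Open Scope ring_scope.

(** * Properties holding on subsets of nearly full measure *)

Definition nearly d (T : measurableType d) (R : realType)
    (mu : set T -> \bar R) (D : set T) (P : set T -> Prop) : Prop :=
  forall eps : R, 0 < eps -> exists A : set T,
    [/\ A `<=` D, measurable A, (mu (D `\` A) < eps%:E)%E & P A].

(** The exceptional set of the n-th property is given measure at most
eps / 2 / 2 ^ (n + 1). The properties must pass to subsets because the witnesses
are intersected. The bounds sum to eps / 2, which leaves room for the strict
inequality that is lost in the series. *)
Lemma nearly_forall d (T : measurableType d) (R : realType)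
    (mu : {measure set T -> \bar R}) (D : set T) (P : nat -> set T -> Prop) :
  measurable D ->
  (forall n A B, A `<=` B -> P n B -> P n A) ->
  (forall n, nearly mu D (P n)) -> nearly mu D (fun A => forall n, P n A).
Proof.
move=> mD Pdown nP eps eps0.
have eps20 n : 0 < eps / 2 / (2 ^ n.+1)%:R by rewrite !divr_gt0.
have /choice[A hA] n := nP n _ (eps20 n).
have AD n : A n `<=` D by have [] := hA n.
have mA n : measurable (A n) by have [] := hA n.
exists (\bigcap_n A n); split.
- by move=> t /(_ 0%N I) /AD.
- exact: bigcapT_measurable.
- apply: (@le_lt_trans _ _ (eps / 2)%:E); last first.
    by rewrite lte_fin; lra.
  apply: (@le_trans _ _ (\sum_(n <oo) mu (D `\` A n))%E).
    apply: measure_sigma_subadditive => [n||].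
    + exact: measurableD.
    + by apply: measurableD => //; exact: bigcapT_measurable.
    + by rewrite setDE setC_bigcap setI_bigcupr.
  have e2 : 0 <= eps / 2 by rewrite divr_ge0 ?ltW.
  apply: le_trans (epsilon_trick0 xpredT e2).
  apply: lee_nneseries => // n _.
  by have [_ _ /ltW] := hA n.
- move=> n; apply: (Pdown n _ (A n)); first exact: bigcap_inf.
  by have [] := hA n.
Qed.

Lemma nearly_and d (T : measurableType d) (R : realType)
    (mu : {measure set T -> \bar R}) (D : set T) (P Q : set T -> Prop) :
  measurable D ->
  (forall A B, A `<=` B -> P B -> P A) ->
  (forall A B, A `<=` B -> Q B -> Q A) ->
  nearly mu D P -> nearly mu D Q -> nearly mu D (fun A => P A /\ Q A).
Proof.
move=> mD Pdown Qdown nP nQ eps /(@nearly_forall _ _ _ mu D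
  (fun n => if n is 0%N then P else Q) mD) [||A [AD mA DA PQ]].
- by case.
- by case.
- by exists A; split=> //; split; [exact: (PQ 0%N)|exact: (PQ 1%N)].
Qed.

(** Continuity from above for the complements of the E n in D, whose
intersection is negligible; this is where the finiteness of [mu D] enters. *)
Lemma nearly_sub_ndseq d (T : measurableType d) (R : realType)
    (mu : {measure set T -> \bar R}) (D : set T) (E : nat -> set T) :
  measurable D -> (mu D < +oo)%E ->
  (forall n, E n `<=` D) -> (forall n, measurable (E n)) ->
  nondecreasing_seq E ->
  {ae mu, forall t, D t -> exists n, E n t} ->
  nearly mu D (fun A => exists n, A `<=` E n).
Proof.
move=> mD Dfin ED mE ndE aeE eps eps0.
pose F n := D `\` E n.
have mF n : measurable (F n) by exact: measurableD.
have mcapF : measurable (\bigcap_n F n) by exact: bigcapT_measurable.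
have F0 : mu (\bigcap_n F n) = 0%E.
  apply/(negligibleP _ mcapF); apply: negligibleS aeE => t Ft /= ex.
  have Dt : D t by have [] := Ft 0%N I.
  by have [n Et] := ex Dt; have [_ ] := Ft n I.
have niF : nonincreasing_seq F.
  by move=> m n mn; apply/subsetPset; apply: setDS; apply/subsetPset/ndE.
have F0fin : (mu (F 0%N) < +oo)%E.
  apply: le_lt_trans Dfin; apply: le_measure; rewrite ?inE//.
  exact: subDsetl.
have := nonincreasing_cvg_mu F0fin mF mcapF niF; rewrite F0 => cvgF.
have : nbhs (0 : \bar R)%E [set x | (x < eps%:E)%E].
  apply: open_nbhs_nbhs; split; last by rewrite /= lte_fin.
  exact: open_ereal_lt_ereal.
move=> /cvgF[n _ /(_ n (leqnn n)) Fn].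
by exists (E n); split => //; exists n.
Qed.

(** The set where [p] holds may fail to be measurable, hence the passage to
the complement of a measurable negligible set containing the exceptions. *)
Lemma nearly_ae d (T : measurableType d) (R : realType)
    (mu : {measure set T -> \bar R}) (D : set T) (p : T -> Prop) :
  measurable D -> {ae mu, forall t, D t -> p t} ->
  nearly mu D (fun A => forall t, A t -> p t).
Proof.
move=> mD [N [mN N0 pN]] eps eps0; exists (D `\` N); split.
- exact: subDsetl.
- exact: measurableD.
- apply: (@le_lt_trans _ _ (mu N)); last by rewrite N0 lte_fin.
  by rewrite setDD; apply: le_measure; rewrite ?inE//; exact: measurableI.
- move=> t [Dt Nt]; apply: contrapT => npt.
  by apply: Nt; apply: pN => /(_ Dt).
Qed.

(** * Uniform and joint continuity *)

Lemma within_continuous_nearP (T : topologicalType) (R : realType) (A : set T)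
    (g : T -> R) :
  {within A, continuous g} <->
  forall x, A x -> forall e, 0 < e ->
    \forall y \near x, A y -> `|g x - g y| < e.
Proof.
rewrite subspace_continuousP; split=> h x Ax.
  by have /cvgrPdist_lt hx := h x Ax.
by apply/cvgrPdist_lt; exact: h.
Qed.

(** Heine-Cantor, with the moduli restricted to the sequence of the
1 / (n + 1) so that they can index a countable family of sets. The near-covering
form of compactness reduces the claim to a neighbourhood of each point, where
continuity with precision e / 2 suffices. *)
Lemma compact_unif_continuous (R : realType) (X : pseudoMetricType R)
    (K : set X) (g : X -> R) (e : R) :
  compact K -> {within K, continuous g} -> 0 < e ->
  \forall n \near \oo, forall x y, K x -> K y -> ball x n.+1%:R^-1 y ->
    `|g x - g y| <= e.
Proof.
move=> /compact_near_coveringP cK /within_continuous_nearP gc e0.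
suff : \forall n \near \oo, K `<=`
    (fun x => K x -> forall y, K y -> ball x n.+1%:R^-1 y -> `|g x - g y| <= e).
  by apply: filterS => n h x y Kx Ky; exact: h.
apply: cK => x Kx.
have e20 : 0 < e / 2 by rewrite divr_gt0.
have /nbhs_ballP[d /= d0 hd] := gc x Kx _ e20.
have d20 : 0 < d / 2 by rewrite divr_gt0.
exists (ball x (d / 2), [set n | n.+1%:R^-1 < d / 2]).
  by split; [exact: nbhsx_ballx|exact: (near_infty_natSinv_lt (PosNum d20))].
move=> [x' n] [/= xx' nd] Kx' y Ky x'y.
have xy : ball x d y.
  rewrite [d]splitr; apply: (ball_triangle xx').
  exact: (le_ball (ltW nd)).
have xx'd : ball x d x' by apply: le_ball xx'; lra.
have := hd _ xy Ky; have := hd _ xx'd Kx'.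
rewrite !ltr_norml ler_norml => /andP[? ?] /andP[? ?].
by apply/andP; split; lra.
Qed.

Definition dense_seq (X : topologicalType) (K : set X) (q : nat -> X) : Prop :=
  (forall i, K (q i)) /\
  forall x, K x -> forall U, nbhs x U -> exists i, U (q i).

(** Approximate x by a point q i at which g is almost equal to g x. Halving
the radius keeps q i within d of q j. One point is left in the sequence: this
is all that [continuous_prod_dense_seq] asks for. *)
Lemma modulus_dense_seq (R : realType) (X : pseudoMetricType R) (K : set X)
    (q : nat -> X) (g : X -> R) (d e : R) :
  dense_seq K q -> {within K, continuous g} -> 0 < d ->
  (forall i j, ball (q i) d (q j) -> `|g (q i) - g (q j)| <= e) ->
  forall x j, K x -> ball x (d / 2) (q j) -> `|g x - g (q j)| <= e.
Proof.
move=> [qK qd] /within_continuous_nearP gc d0 gq x j Kx xj.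
apply/ler_addgt0Pr => r r0.
have d20 : 0 < d / 2 by rewrite divr_gt0.
have [i [xi gi]] := qd x Kx _ (filterI (nbhsx_ballx x _ d20) (gc x Kx _ r0)).
have ij : ball (q i) d (q j).
  by rewrite [d]splitr; apply: ball_triangle xj; exact: ball_sym.
rewrite -(subrKA (g (q i))) addrC (le_trans (ler_normD _ _))// lerD//.
  exact: gq.
exact/ltW/gi.
Qed.

(** To compare f (t, x) with f (s, y), choose q i within d / 2 of x and keep y
within d / 2 of x: the steps from x to q i and from q i to y cost e / 3 each by
the common modulus, the step from t to s along q i costs e / 3 by continuity. *)
Lemma continuous_prod_dense_seq (R : realType) (S : topologicalType)
    (X : pseudoMetricType R) (T : set S) (K : set X) (q : nat -> X)
    (f : S * X -> R) :
  dense_seq K q ->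
  (forall i, {within T, continuous (fun t => f (t, q i))}) ->
  (forall e, 0 < e -> exists2 d, 0 < d & forall t x i, T t -> K x ->
     ball x d (q i) -> `|f (t, x) - f (t, q i)| <= e) ->
  {within T `*` K, continuous f}.
Proof.
move=> [qK qd] fc fe; apply/within_continuous_nearP => -[t x] [/= Tt Kx] e e0.
have e30 : 0 < e / 3 by rewrite divr_gt0.
have [d d0 fd] := fe _ e30.
have d20 : 0 < d / 2 by rewrite divr_gt0.
have [i xi] := qd x Kx _ (nbhsx_ballx x _ d20).
have /within_continuous_nearP/(_ t Tt _ e30) ft := fc i.
exists ([set s | T s -> `|f (t, q i) - f (s, q i)| < e / 3], ball x (d / 2)).
  by split=> //; exact: nbhsx_ballx.
move=> [s y] [/= sT xy] [/= Ts Ky].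
have xid : ball x d (q i) by apply: le_ball xi; lra.
have yid : ball y d (q i).
  by rewrite [d]splitr; apply: ball_triangle xi; exact: ball_sym.
have := fd _ _ _ Tt Kx xid; have := fd _ _ _ Ts Ky yid; have := sT Ts.
rewrite !ltr_norml !ler_norml => /andP[? ?] /andP[? ?] /andP[? ?].
by apply/andP; split; lra.
Qed.

(** * Measurability of the sections and exceptional sets *)

(** Preimages of Borel sets by the continuous map t |-> (t, x) are Borel,
because the sets with a Borel preimage form a sigma-algebra containing the
open sets. *)
Lemma borel_measurable_section (R : realType) (X : topologicalType)
    (D : set R) (K : set X) (f : R * X -> R) (x : X) :
  @borel_measurable_fun (R * X)%type R (D `*` K) f -> K x ->
  measurable_fun D (fun t => f (t, x)).
Proof.
move=> fb Kx _ B mB; pose s (t : R) := (t, x).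
have -> : D `&` (fun t => f (t, x)) @^-1` B =
    s @^-1` ((D `*` K) `&` f @^-1` B).
  by apply/seteqP; split=> t; rewrite /s /=; tauto.
have := fb B mB; move: (_ `&` _) => C.
apply: (@smallest_sub _ _ _ [set U | measurable (s @^-1` U)]) => {C};
  last first.
  move=> U oU /=; apply: open_measurable; apply: open_comp oU => t _.
  exact: cvg_pair cvg_id (cvg_cst x).
split=> [|U mU|U mU] /=.
- by rewrite preimage_set0.
- by rewrite setTD preimage_setC; exact: measurableC.
- by rewrite preimage_bigcup; exact: bigcupT_measurable.
Qed.

Lemma nearly_continuous (R : realType) (D : set R) (f : R -> R) :
  measurable D -> (lebesgue_measure D < +oo)%E -> measurable_fun D f ->
  nearly lebesgue_measure D (fun A => {within A, continuous f}).
Proof.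
move=> mD Dfin mf eps eps0.
have [K [cK KD DK fK]] := measurable_almost_continuous mD Dfin eps0 mf.
exists K; split=> //; apply: closed_measurable.
by apply: compact_closed => //; exact: Rhausdorff.
Qed.

(** The sets on which 1 / (n + 1) serves as a modulus at precision e increase
to almost all of D, as each continuous f (t, .) is uniformly continuous on K. The
witness also avoids the t with a discontinuous section, so that the bound on
the points of q extends to K. *)
Lemma nearly_equicontinuous d (S : measurableType d) (R : realType)
    (mu : {measure set S -> \bar R}) (X : pseudoMetricType R)
    (D : set S) (K : set X) (q : nat -> X) (f : S * X -> R) (e : R) :
  measurable D -> (mu D < +oo)%E ->
  compact K -> dense_seq K q ->
  (forall i, measurable_fun D (fun t => f (t, q i))) ->
  {ae mu, forall t, D t ->
    {within K, continuous (fun x => f (t, x))}} ->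
  0 < e ->
  nearly mu D (fun A => exists2 r, 0 < r &
    forall t x i, A t -> K x -> ball x r (q i) ->
      `|f (t, x) - f (t, q i)| <= e).
Proof.
move=> mD Dfin cK qK mf fc e0.
(* Only points of q are compared, so that E n is a countable intersection. *)
pose E n := D `&` [set t | forall i j, ball (q i) n.+1%:R^-1 (q j) ->
  `|f (t, q i) - f (t, q j)| <= e].
have mE n : measurable (E n).
  have -> : E n = \bigcap_i \bigcap_j (D `&` [set t |
      ball (q i) n.+1%:R^-1 (q j) -> `|f (t, q i) - f (t, q j)| <= e]).
    apply/seteqP; split=> t.
      by move=> [Dt h] i _ j _; split=> //; exact: h.
    move=> h; split; first by have [] := h 0%N I 0%N I.
    by move=> i j; have [_] := h i I j I.
  apply: bigcapT_measurable => i; apply: bigcapT_measurable => j.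
  have [b|nb] := pselect (ball (q i) n.+1%:R^-1 (q j)); last first.
    rewrite (_ : [set _ | _] = setT) ?setIT//.
    by apply/seteqP; split=> t //= _ /nb.
  rewrite (_ : [set _ | _] =
    (fun t => `|f (t, q i) - f (t, q j)|) @^-1` `]-oo, e]); last first.
    by apply/seteqP; split=> t /=; rewrite in_itv/=; [apply|].
  have : measurable_fun D (fun t => `|f (t, q i) - f (t, q j)|).
    by apply: measurableT_comp => //; exact: measurable_funB.
  by apply.
have ndE : nondecreasing_seq E.
  move=> m n mn; apply/subsetPset => t [Dt h]; split=> // i j ij; apply: h.
  by apply: le_ball ij; rewrite lef_pV2 ?posrE// ler_nat ltnS.
have aeE : {ae mu, forall t, D t -> exists n, E n t}.
  apply: filterS fc => t fct Dt.
  have [n _ /(_ n (leqnn n)) h] := compact_unif_continuous cK (fct Dt) e0.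
  by exists n; split=> // i j; apply: h; apply qK.
have nE := nearly_sub_ndseq mD Dfin (fun n => @subIsetl _ _ _) mE ndE aeE.
have nc := nearly_ae mD fc.
move=> eps /(nearly_and mD _ _ nE nc)[||A [AD mA DA [[n AE] Ac]]].
- by move=> A B AB [n BE]; exists n; exact: subset_trans BE.
- by move=> A B AB h t At; exact: h (AB t At).
exists A; split=> //; exists (n.+1%:R^-1 / 2); first by rewrite divr_gt0.
move=> t x i At; have [_ h] := AE t At.
exact: modulus_dense_seq qK (Ac t At) _ h x i.
Qed.

(** * The Scorza-Dragoni property *)

(** Rationals clamped to [0, 1]: clamping does not increase the distance to a
point of [0, 1], so density is inherited even at the end points. *)
Lemma itv01_dense_seq (R : realType) :
  exists q : nat -> R, dense_seq (`[0, 1] : set R) q.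
Proof.
pose c (x : R) := Num.max 0 (Num.min 1 x).
have c01 x : c x \in `[0, 1] by
  rewrite in_itv/= /c le_max lexx/= ge_max ler01 ge_min lexx.
have cdist x y : x \in `[0, 1] -> `|x - c y| <= `|x - y|.
  rewrite in_itv/= /c => /andP[x0 x1]; rewrite /Num.max /Num.min.
  by case: (ltP 1 y) => ?; case: ltP => ?; rewrite !ler_normr;
     case: (ger0P (x - _)) => ?; apply/orP; lra.
exists (fun n => c (ratr (odflt 0 (unpickle n)))); split=> [i|x x01 U].
  exact: c01.
move=> /nbhs_ballP[d /= d0 dU].
have /rat_in_itvoo[r] : x < x + d by rewrite ltrDl.
rewrite in_itv/= => /andP[xr rd].
exists (pickle r); apply: dU; rewrite pickleK/= /ball/=.
apply: le_lt_trans (cdist _ _ x01) _.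
by rewrite ltr_norml; apply/andP; split; lra.
Qed.

Lemma scorza_dragoni (R : realType) (X : pseudoMetricType R)
    (D : set R) (K : set X) (q : nat -> X) (f : R * X -> R) :
  measurable D -> (lebesgue_measure D < +oo)%E ->
  compact K -> dense_seq K q ->
  @borel_measurable_fun (R * X)%type R (D `*` K) f ->
  {ae (@lebesgue_measure R), forall t, D t ->
    {within K, continuous (fun x => f (t, x))}} ->
  nearly lebesgue_measure D (fun A => {within A `*` K, continuous f}).
Proof.
move=> mD Dfin cK qK fb fc.
have mf i : measurable_fun D (fun t => f (t, q i)).
  by apply: borel_measurable_section fb _; apply qK.
have cdown n (A B : set R) : A `<=` B ->
    {within B, continuous (fun t => f (t, q n))} ->
    {within A, continuous (fun t => f (t, q n))}.
  exact: continuous_subspaceW.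
have n1 : nearly lebesgue_measure D (fun A => forall n,
    {within A, continuous (fun t => f (t, q n))}).
  (* The Lebesgue measure lives on [measurableTypeR R], whose measurable sets
     are only convertible to those of R, hence the explicit type. *)
  apply: (@nearly_forall _ (measurableTypeR R) _ _ _ _ mD cdown) => n.
  exact: nearly_continuous.
pose P n (A : set R) := exists2 d, 0 < d & forall t x i, A t -> K x ->
  ball x d (q i) -> `|f (t, x) - f (t, q i)| <= n.+1%:R^-1 :> R.
have Pdown n A B : A `<=` B -> P n B -> P n A.
  by move=> AB [d d0 h]; exists d => // t x i /AB; exact: h.
have n2 : nearly lebesgue_measure D (fun A => forall n, P n A).
  apply: (@nearly_forall _ (measurableTypeR R) _ _ _ _ mD Pdown) => n.
  exact: (@nearly_equicontinuous _ (measurableTypeR R) R lebesgue_measure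
    X D K q f _ mD Dfin cK qK mf fc (harmonic_gt0 n)).
move=> eps /(@nearly_and _ (measurableTypeR R) _ _ _ _ _ mD _ _ n1 n2)
  [||A [AD mA DA [Ac AP]]].
- by move=> A B AB h n; exact: cdown AB (h n).
- by move=> A B AB h n; exact: Pdown AB (h n).
exists A; split=> //; apply: (continuous_prod_dense_seq qK) => // e e0.
have [n _ /(_ n (leqnn n)) /= ne] := near_infty_natSinv_lt (PosNum e0).
have [d d0 h] := AP n; exists d => // t x i At Kx xi.
exact: le_trans (h _ _ _ At Kx xi) (ltW ne).
Qed.

Theorem theorem5p1 (R : realType) (f : R * R -> R)
    (f_borel : @borel_measurable_fun (R * R)%type R (`[0, 1] `*` `[0, 1]) f)
    (f_cont : {ae (@lebesgue_measure R), forall t : R, t \in `[0, 1] ->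
      {within `[0, 1], continuous (fun x : R => f (t, x))}}) :
  forall eps : R, 0 < eps ->
    exists T : set R,
      [/\ T `<=` `[0, 1],
          measurable T,
          (lebesgue_measure (`[0%R, 1%R] `\` T) < eps%:E)%E &
          {within T `*` `[0, 1], continuous f}].
Proof.
have [q qd] := itv01_dense_seq R.
apply: scorza_dragoni qd f_borel f_cont => //.
- by rewrite lebesgue_measure_itv/= lte_fin ltr01 -EFinD ltry.
- exact: segment_compact.
Qed.
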